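(* Let $\mathbf{S}$ be a sequent and let $\mathcal{T}$ be a test. Then the following are equivalent: (1) $\mathcal{T}$ comes from a derivation of $\mathbf{S}$; (2) the interaction between $\mathcal{T}$ and $\neg\mathbf{S}$ does not produce errors.
   Context: Positions are finite sequences of natural numbers; $\langle\rangle$ is the empty one, $\star$ is concatenation, $\langle i\rangle$ is the length-one position. A tree labeled by a set $L$ is a partial function from positions to $L$ whose domain contains $\langle\rangle$ and is closed under prefixes; a leaf is a domain element with no proper extension in the domain; the subtree $T_p$ is $q\mapsto T(p\star q)$ on $\{q: p\star q\in\mathrm{dom}(T)\}$. For a tree labeled by a product $A\times B$, $T_L(p)$ and $T_R(p)$ denote the two components of $T(p)$. Formulas: trees labeled by $\{\vee,\wedge\}\cup\{\mathbf{v}=(+,v)\}\cup\{\neg\mathbf{v}=(-,v)\}$ ($v\in\mathbb{N}$) in which variable-labeled positions are leaves. A compound formula $\mathbf{F}$ with root label $\vee$ (resp. $\wedge$) and arity $I=\{i\in\mathbb{N}:\langle i\rangle\in\mathrm{dom}(\mathbf{F})\}$ is written $\vee_I \mathbf{F}_{\langle i\rangle}$ (resp. $\wedge_I\mathbf{F}_{\langle i\rangle}$); $\vee[\mathbf{F}_0,\dots,\mathbf{F}_{n-1}]$ denotes the disjunctive formula of arity $\{0,\dots,n-1\}$ with immediate subformulas $\mathbf{F}_k$, similarly for $\wedge$. Negation $\neg\mathbf{F}$ swaps $\mathbf{v}\leftrightarrow\neg\mathbf{v}$ and $\vee\leftrightarrow\wedge$ at every position (so $\neg\vee_I\mathbf{F}_{\langle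 i\rangle}=\wedge_I\neg\mathbf{F}_{\langle i\rangle}$). A sequent is a disjunctive formula $\vee[\mathbf{F}_0,\dots,\mathbf{F}_{n-1}]$ ($n\in\mathbb{N}$); for a formula $\mathbf{G}$, $\mathbf{S}\vee\mathbf{G}$ denotes $\vee[\mathbf{F}_0,\dots,\mathbf{F}_{n-1},\mathbf{G}]$. An environment is the negation of a sequent, i.e. $\wedge[\mathbf{G}_0,\dots,\mathbf{G}_{m-1}]$; $\mathbf{E}\wedge\mathbf{H}$ denotes $\wedge[\mathbf{G}_0,\dots,\mathbf{G}_{m-1},\mathbf{H}]$. Rules: axiom rules $(\mathbf{v},k,\ell)$ with $\mathbf{v}$ a positive variable and $k,\ell\in\mathbb{N}$; disjunctive rules $(\vee,k,i_0)$ with $k,i_0\in\mathbb{N}$; conjunctive rules $(\wedge,k)$ with $k\in\mathbb{N}$. A derivation is a tree $T$ labeled by (sequents)$\times$(rules) such that for each $p\in\mathrm{dom}(T)$, writing $T_L(p)=\vee[\mathbf{F}_0,\dots,\mathbf{F}_{n-1}]$, one of: (ax) $T_R(p)=(\mathbf{v},k,\ell)$, $k,\ell<n$, $\mathbf{F}_k=\mathbf{v}$, $\mathbf{F}_\ell=\neg\mathbf{v}$, and $p$ is a leaf; ($\vee$) $T_R(p)=(\vee,k,i_0)$, $k<n$, $\mathbf{F}_k=\vee_I\mathbf{G}_{\langle i\rangle}$, $i_0\in I$, $p\star\langle i\rangle\in\mathrm{dom}(T)$ iff $i=i_0$, and $T_L(p\star\langle i_0\rangle)=T_L(p)\vee\mathbf{G}_{\langle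 i_0\rangle}$; ($\wedge$) $T_R(p)=(\wedge,k)$, $k<n$, $\mathbf{F}_k=\wedge_I\mathbf{G}_{\langle i\rangle}$, $p\star\langle i\rangle\in\mathrm{dom}(T)$ iff $i\in I$, and $T_L(p\star\langle i\rangle)=T_L(p)\vee\mathbf{G}_{\langle i\rangle}$ for all $i\in I$. Derivations may be ill-founded. $\pi$ is a derivation of $\mathbf{S}$ if $\pi_L(\langle\rangle)=\mathbf{S}$. A test is a tree labeled by rules whose domain is the set of all positions. A test $\mathcal{T}$ comes from the derivation $\pi$ of $\mathbf{S}$ if $\mathcal{T}(p)=\pi_R(p)$ for all $p\in\mathrm{dom}(\pi)$. Configurations are pairs (test, environment) or a special symbol $\Uparrow$ (error). The interaction tree $\mathrm{CT}(c)$ of a configuration $c$ is the tree labeled by configurations with root labeled $c$, built as follows for each $p$ in its domain: if the label is $\Uparrow$, $p$ is a leaf. If the label is $(\mathcal{T},\wedge[\mathbf{G}_0,\dots,\mathbf{G}_{m-1}])=(\mathcal{T},\mathbf{E})$: if $\mathcal{T}(\langle\rangle)=(\mathbf{v},k,\ell)$, $k,\ell<m$, $\mathbf{G}_k=\neg\mathbf{v}$, $\mathbf{G}_\ell=\mathbf{v}$, then $p$ is a leaf; if $\mathcal{T}(\langle\rangle)=(\vee,k,i_0)$, $k<m$, $\mathbf{G}_k=\wedge_I\mathbf{H}_{\langle i\rangle}$, $i_0\in I$, then $p$'s only child is $p\star\langle i_0\rangle$, labeled $(\mathcal{T}_{\langle i_0\rangle},\mathbf{E}\wedge\mathbf{H}_{\langle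 i_0\rangle})$; if $\mathcal{T}(\langle\rangle)=(\wedge,k)$, $k<m$, $\mathbf{G}_k=\vee_I\mathbf{H}_{\langle i\rangle}$, then the children of $p$ are $p\star\langle i\rangle$ for $i\in I$, labeled $(\mathcal{T}_{\langle i\rangle},\mathbf{E}\wedge\mathbf{H}_{\langle i\rangle})$; in all other cases, $p$'s only child is $p\star\langle 0\rangle$, labeled $\Uparrow$. The interaction between a test $\mathcal{T}$ and an environment $\mathbf{E}$ does not produce errors if no position of $\mathrm{CT}((\mathcal{T},\mathbf{E}))$ is labeled $\Uparrow$. *)

(* Defs.v *)
From mathcomp Require Import all_boot boolp.

Set Implicit Arguments.
Unset Strict Implicit.
Unset Printing Implicit Defensive.

(** * Labeled trees *)

Notation position := (seq nat).

(* A partial function is rendered by its values in [option L]; the domain is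
   where the value is not [None]. *)
Record tree (L : Type) := Tree {
  tree_fun :> position -> option L;
  tree_root : isSome (tree_fun [::]);
  tree_prefix : forall p q, isSome (tree_fun (p ++ q)) -> isSome (tree_fun p)
}.

Definition dom L (T : tree L) (p : position) : bool := isSome (T p).

Definition is_leaf L (T : tree L) (p : position) : Prop :=
  dom T p /\ forall q, q <> [::] -> ~~ dom T (p ++ q).

Definition some_value L (o : option L) : isSome o -> L :=
  match o with
  | Some x => fun=> x
  | None => fun h => False_rect L (notF h)
  end.

Definition root L (T : tree L) : L := some_value (tree_root T).

Lemma rootE L (T : tree L) : T [::] = Some (root T).
Proof. by rewrite /root; case: (T [::]) (tree_root T). Qed.

Lemma subtree_root L (T : tree L) p : dom T p -> isSome (T (p ++ [::])).
Proof. by rewrite cats0. Qed.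

Lemma subtree_prefix L (T : tree L) (p q r : position) :
  isSome (T (p ++ (q ++ r))) -> isSome (T (p ++ q)).
Proof. by rewrite catA; apply: tree_prefix. Qed.

Definition subtree L (T : tree L) (p : position) (h : dom T p) : tree L :=
  @Tree L (fun q => T (p ++ q)) (subtree_root h) (@subtree_prefix L T p).

(** * Formulas *)

Inductive connective := Or | And.

Inductive flabel :=
  | Conn of connective
  | Pos of nat
  | Neg of nat.

Definition is_variable (l : flabel) : bool := if l is Conn _ then false else true.

Record formula := Formula {
  formula_tree :> tree flabel;
  formula_leaf : forall p l,
    formula_tree p = Some l -> is_variable l -> is_leaf formula_tree p
}.

Lemma formula_eq (F G : formula) : (forall p, F p = G p) -> F = G.
Proof.
case: F G => [[f rf pf] lf] [[g rg pg] lg] /= /funext efg.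
subst g; rewrite (Prop_irrelevance rg rf) (Prop_irrelevance pg pf) in lg *.
by rewrite (Prop_irrelevance lg lf).
Qed.

Lemma subformula_leaf (F : formula) p (h : dom F p) q l :
  subtree h q = Some l -> is_variable l -> is_leaf (subtree h) q.
Proof.
move=> /= e vl; have [d c] := formula_leaf e vl; split=> // r r0.
by rewrite /dom /= catA; apply: c.
Qed.

Definition subformula (F : formula) (p : position) (h : dom F p) : formula :=
  Formula (@subformula_leaf F p h).

(* [immediate F i] is F_<i> if i belongs to the arity of F, and [None]
   otherwise. *)
Definition immediate (F : formula) (i : nat) : option formula :=
  match @idP (dom F [:: i]) with
  | ReflectT h => Some (subformula h)
  | ReflectF _ => None
  end.

Definition variable_fun (l : flabel) (p : position) : option flabel :=
  if p is [::] then Some l else None.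

Lemma variable_prefix l (p q : position) :
  isSome (variable_fun l (p ++ q)) -> isSome (variable_fun l p).
Proof. by case: p. Qed.

Definition variable_tree (l : flabel) : tree flabel :=
  @Tree _ (variable_fun l) isT (variable_prefix (l := l)).

Lemma variable_leaf l p l' :
  variable_tree l p = Some l' -> is_variable l' -> is_leaf (variable_tree l) p.
Proof. by case: p => //= _ _; split=> // -[]. Qed.

Definition variable (l : flabel) : formula := Formula (@variable_leaf l).

Definition pos_var (v : nat) : formula := variable (Pos v).
Definition neg_var (v : nat) : formula := variable (Neg v).

Definition compound_fun (c : connective) (Fs : seq formula) (p : position) :
    option flabel :=
  match p with
  | [::] => Some (Conn c)
  | i :: q => if onth Fs i is Some F then F q else None
  end.

Lemma compound_prefix c Fs (p q : position) :
  isSome (compound_fun c Fs (p ++ q)) -> isSome (compound_fun c Fs p).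
Proof.
by case: p => //= i p; case: (onth Fs i) => // F; apply: tree_prefix.
Qed.

Definition compound_tree (c : connective) (Fs : seq formula) : tree flabel :=
  @Tree _ (compound_fun c Fs) isT (@compound_prefix c Fs).

Lemma compound_leaf c Fs p l :
  compound_tree c Fs p = Some l -> is_variable l ->
  is_leaf (compound_tree c Fs) p.
Proof.
case: p => [[<-]|i p] //=.
rewrite /is_leaf /dom /=; case: (onth Fs i) => // F e vl.
exact: formula_leaf e vl.
Qed.

(* [compound c [:: F_0; ...; F_(n-1)]] has root connective c and arity
   {0, ..., n-1}. *)
Definition compound (c : connective) (Fs : seq formula) : formula :=
  Formula (@compound_leaf c Fs).

Definition neg_connective (c : connective) : connective :=
  match c with Or => And | And => Or end.

Definition neg_label (l : flabel) : flabel :=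
  match l with
  | Conn c => Conn (neg_connective c)
  | Pos v => Neg v
  | Neg v => Pos v
  end.

Lemma isSome_omap A B (f : A -> B) (o : option A) :
  isSome (omap f o) = isSome o.
Proof. by case: o. Qed.

Lemma neg_root (F : formula) : isSome (omap neg_label (F [::])).
Proof. by rewrite isSome_omap; apply: tree_root. Qed.

Lemma neg_prefix (F : formula) (p q : position) :
  isSome (omap neg_label (F (p ++ q))) -> isSome (omap neg_label (F p)).
Proof. by rewrite !isSome_omap; apply: tree_prefix. Qed.

Definition neg_tree (F : formula) : tree flabel :=
  @Tree _ (fun p => omap neg_label (F p)) (neg_root F) (@neg_prefix F).

Lemma neg_leaf (F : formula) p l :
  neg_tree F p = Some l -> is_variable l -> is_leaf (neg_tree F) p.
Proof.
move=> /=; case e: (F p) => [l'|] //= [<-] vl.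
have /(formula_leaf e) [d c] : is_variable l' by case: (l') vl.
by split=> [|q q0]; rewrite /dom /= isSome_omap //; apply: c.
Qed.

Definition neg (F : formula) : formula := Formula (@neg_leaf F).

(** * Sequents and environments *)

(* A sequent is given by its list of components; as a formula it is their
   disjunction, and this representation is unique by [compound_inj]. *)
Record sequent := Sequent { components : seq formula }.
Coercion formula_of_sequent (S : sequent) : formula :=
  compound Or (components S).

Record environment := Environment { env_components : seq formula }.
Coercion formula_of_environment (E : environment) : formula :=
  compound And (env_components E).

Definition sequent_or (S : sequent) (G : formula) : sequent :=
  Sequent (rcons (components S) G).

Definition environment_and (E : environment) (H : formula) : environment :=
  Environment (rcons (env_components E) H).

Definition neg_sequent (S : sequent) : environment :=
  Environment (map neg (components S)).

Lemma neg_sequentE (S : sequent) : neg_sequent S = neg S :> formula.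
Proof.
apply: formula_eq => -[|i p] //=; rewrite onth_map.
by case: (onth _ i).
Qed.

Lemma compound_inj c : injective (compound c).
Proof.
move=> Fs Gs e.
have {}e p : compound c Fs p = compound c Gs p by rewrite e.
elim: Fs Gs e => [|F Fs IH] [|G Gs] // e.
- by have := e [:: 0]; rewrite /= rootE.
- by have := e [:: 0]; rewrite /= rootE.
congr cons; first by apply: formula_eq => p; apply: (e (0 :: p)).
by apply: IH => -[|i p] //; apply: (e (i.+1 :: p)).
Qed.

(** * Rules, derivations and tests *)

Inductive rule :=
  | RAx of nat & nat & nat
  | ROr of nat & nat
  | RAnd of nat.

(* [onth s k = Some F] says that k < size s and that the k-th element of s
   is F. *)
Definition is_derivation (T : tree (sequent * rule)) : Prop :=
  forall p S r, T p = Some (S, r) ->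
  match r with
  | RAx v k l =>
      [/\ onth (components S) k = Some (pos_var v),
          onth (components S) l = Some (neg_var v)
        & is_leaf T p]
  | ROr k i0 =>
      exists F G : formula,
      [/\ onth (components S) k = Some F,
          root F = Conn Or,
          immediate F i0 = Some G,
          (forall i, dom T (p ++ [:: i]) <-> i = i0)
        & omap fst (T (p ++ [:: i0])) = Some (sequent_or S G)]
  | RAnd k =>
      exists F : formula,
      [/\ onth (components S) k = Some F,
          root F = Conn And,
          (forall i, dom T (p ++ [:: i]) <-> dom F [:: i])
        & forall i G, immediate F i = Some G ->
          omap fst (T (p ++ [:: i])) = Some (sequent_or S G)]
  end.

Definition derivation_of (T : tree (sequent * rule)) (S : sequent) : Prop :=
  is_derivation T /\ (root T).1 = S.

Record test := Test {
  test_tree :> tree rule;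
  test_total : forall p, dom test_tree p
}.

Definition subtest (T : test) (p : position) : test :=
  @Test (subtree (test_total T p)) (fun q => test_total T (p ++ q)).

Definition comes_from (T : test) (pi : tree (sequent * rule)) : Prop :=
  forall p, dom pi p -> T p = omap snd (pi p).

(** * Interaction *)

Inductive configuration :=
  | Conf of test & environment
  | Error.

Definition error_child (i : nat) : option configuration :=
  if i == 0 then Some Error else None.

(* [child c i] is the label of the child number i of a position labeled c, or
   [None] if there is no such child. *)
Definition child (c : configuration) : nat -> option configuration :=
  match c with
  | Error => fun=> None
  | Conf T E =>
      match root T with
      | RAx v k l =>
          if `[< onth (env_components E) k = Some (neg_var v) /\
                 onth (env_components E) l = Some (pos_var v) >]
          then fun=> None
          else error_child
      | ROr k i0 =>
          if onth (env_components E) k is Some G then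
            match root G, immediate G i0 with
            | Conn And, Some H => fun i =>
                if i == i0
                then Some (Conf (subtest T [:: i0]) (environment_and E H))
                else None
            | _, _ => error_child
            end
          else error_child
      | RAnd k =>
          if onth (env_components E) k is Some G then
            if root G is Conn Or then fun i =>
              omap (fun H => Conf (subtest T [:: i]) (environment_and E H))
                   (immediate G i)
            else error_child
          else error_child
      end
  end.

Fixpoint interaction_fun (c : configuration) (p : position) :
    option configuration :=
  match p with
  | [::] => Some c
  | i :: q => if child c i is Some c' then interaction_fun c' q else None
  end.

Lemma interaction_prefix c (p q : position) :
  isSome (interaction_fun c (p ++ q)) -> isSome (interaction_fun c p).
Proof. by elim: p c => //= i p IH c; case: (child c i). Qed.

Definition interaction_tree (c : configuration) : tree configuration :=
  @Tree _ (interaction_fun c) isT (@interaction_prefix c).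

Lemma interaction_tree_child c p i :
  interaction_tree c (p ++ [:: i]) =
  obind (fun d => child d i) (interaction_tree c p).
Proof.
by elim: p c => [|j p IH] c /=; [case: child | case: (child c j)].
Qed.

Definition no_error (T : test) (E : environment) : Prop :=
  forall p, interaction_tree (Conf T E) p <> Some Error.

(* Main.v *)
(** Negating the environments of the interaction tree of (T, not S) turns its
    transition rules into the local correctness conditions of derivations: if
    no error occurs, this relabeling is a derivation of S from which T comes.
    Conversely, if T comes from a derivation of S, then by induction on the
    position every label of the interaction tree is the negation of the sequent
    of the derivation at the same position, paired with the corresponding
    subtest; hence it is not an error. *)
From mathcomp Require Import all_boot boolp.
Require Import Defs.

Set Implicit Arguments.
Unset Strict Implicit.
Unset Printing Implicit Defensive.

Lemma root_eq L (T : tree L) x : T [::] = Some x -> root T = x.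
Proof. by rewrite rootE => -[]. Qed.

(** A proper extension of [p] in the domain passes through some [p ++ [:: i]], which prefix closure
    puts in the domain. *)
Lemma leaf_no_child L (T : tree L) p :
  dom T p -> (forall i, ~~ dom T (p ++ [:: i])) -> is_leaf T p.
Proof.
move=> dp nc; split=> // -[|i q] // _; apply: contra (nc i).
by rewrite -cat1s catA; apply: tree_prefix.
Qed.

Lemma negK : involutive neg.
Proof.
by move=> F; apply: formula_eq => p /=; case: (F p) => [[[]| |]|].
Qed.

Lemma omap_neg_eq o G : omap neg o = Some (neg G) -> o = Some G.
Proof. by move=> /(congr1 (omap neg)); case: o => //= F; rewrite !negK. Qed.

Lemma neg_pos_var v : neg (pos_var v) = neg_var v.
Proof. by apply: formula_eq => -[]. Qed.

Lemma neg_neg_var v : neg (neg_var v) = pos_var v.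
Proof. by apply: formula_eq => -[]. Qed.

Lemma root_neg F : root (neg F) = neg_label (root F).
Proof. by apply: root_eq; rewrite /= rootE. Qed.

(** Formulas with the same labels are equal, so [immediate] can be handled without the domain proof
    inside [subformula]. *)
Lemma immediateP F i G :
  immediate F i = Some G <->
  dom F [:: i] /\ forall p, G p = F (i :: p).
Proof.
rewrite /immediate; case: {-}_ / idP => [h|h]; split.
- by case=> <-.
- by case=> _ e; congr Some; apply: formula_eq => p; rewrite e.
- by [].
- by case.
Qed.

Lemma immediate_neg F i : immediate (neg F) i = omap neg (immediate F i).
Proof.
case e: (immediate F i) => [G|] /=.
  have [d eG] := (immediateP _ _ _).1 e.
  apply/immediateP; split=> [|p /=]; last by rewrite eG.
  by rewrite /dom /= isSome_omap.
case e': (immediate (neg F) i) => [G|] //.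
have [d eG] := (immediateP _ _ _).1 e'.
(* An immediate subformula of [neg F] at [i] would negate to one of [F] at [i], and [F] has none. *)
suff : immediate F i = Some (neg G) by rewrite e.
apply/immediateP; split=> [|p /=]; first by rewrite /dom /= isSome_omap in d.
by rewrite eG /=; case: (F _) => [[[]| |]|].
Qed.

Lemma isSome_immediate F i : isSome (immediate F i) = dom F [:: i].
Proof.
by rewrite /immediate; case: {-}_ / idP => [h|/negP/negbTE h]; rewrite [RHS]h.
Qed.

Lemma neg_sequent_or S G :
  neg_sequent (sequent_or S G) = environment_and (neg_sequent S) (neg G).
Proof. by rewrite /neg_sequent /environment_and /= map_rcons. Qed.

Lemma onth_neg_sequent S k :
  onth (env_components (neg_sequent S)) k = omap neg (onth (components S) k).
Proof. exact: onth_map. Qed.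

Definition neg_environment (E : environment) : sequent :=
  Sequent (map neg (env_components E)).

Lemma neg_environmentK : cancel neg_environment neg_sequent.
Proof. by case=> Gs; rewrite /neg_sequent /= (mapK negK). Qed.

Lemma neg_sequentK : cancel neg_sequent neg_environment.
Proof. by case=> Fs; rewrite /neg_environment /= (mapK negK). Qed.

(** Each branch without error moves to the subtest at the child's own index; for a disjunctive rule
    that index can only be [i0]. *)
Lemma child_test T E i T' E' :
  child (Conf T E) i = Some (Conf T' E') -> T' = subtest T [:: i].
Proof.
have err : error_child i <> Some (Conf T' E').
  by rewrite /error_child; case: ifP.
rewrite /=; case: (root T) => [v k l|k i0|k].
- by case: ifP.
- case: (onth _ _) => [G|//]; case: (root G) => [[]||] //.
  by case: (immediate G i0) => [H|//]; case: eqP => // -> [].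
case: (onth _ _) => [G|//]; case: (root G) => [[]||] //.
by case: (immediate G i) => [H [<-]|].
Qed.

Lemma interaction_tree_cons c i p :
  interaction_tree c (i :: p) =
  obind (fun d => interaction_tree d p) (child c i).
Proof. by []. Qed.

(** Subtests compose along a path. The statement compares values, which avoids the proofs stored in
    the records. *)
Lemma interaction_test T E p T' E' :
  interaction_tree (Conf T E) p = Some (Conf T' E') ->
  forall q, T' q = T (p ++ q).
Proof.
elim: p T E => [|i p IH] T E; first by case=> ->.
rewrite interaction_tree_cons; case e: (child _ i) => [[T1 E1|]|] //.
  2: by case: p {IH}.
by move=> /IH h q; rewrite h (child_test e).
Qed.

Lemma interaction_rule T E p T' E' :
  interaction_tree (Conf T E) p = Some (Conf T' E') -> T p = Some (root T').
Proof. by move=> /interaction_test h; rewrite -rootE h cats0. Qed.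

Lemma derivation_no_error S T pi :
  derivation_of pi S -> comes_from T pi -> no_error T (neg_sequent S).
Proof.
move=> [der rS] from.
(* The invariant keeps [p] in the domain of [pi]: there [comes_from] identifies the rule of the test
   with that of [pi], whose local condition then fixes the children. *)
suff inv p c : interaction_tree (Conf T (neg_sequent S)) p = Some c ->
    exists S' r T', pi p = Some (S', r) /\ c = Conf T' (neg_sequent S').
  by move=> p /inv [S' [r [T' []]]].
elim/last_ind: p c => [|p i IH] c.
  move=> [<-]; exists S, (root pi).2, T.
  by rewrite rootE -rS; case: (root pi).
rewrite -cats1 interaction_tree_child.
case e: (interaction_tree _ p) => [d|//].
have [S' [r [T' [epi ed]]]] := IH _ e; subst d.
have rT' : root T' = r.
  by move: (from p); rewrite /dom epi (interaction_rule e) => /(_ isT) [].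
move: (der _ _ _ epi); rewrite [obind _ _]/= rT'.
(* Shared by the two connectives: extending the sequent by [G] matches extending the environment by
   [neg G]. *)
have step G : omap fst (pi (p ++ [:: i])) = Some (sequent_or S' G) ->
    Some (Conf (subtest T' [:: i])
            (environment_and (neg_sequent S') (neg G))) = Some c ->
    exists S1 r1 T1,
      pi (p ++ [:: i]) = Some (S1, r1) /\ c = Conf T1 (neg_sequent S1).
  case: (pi _) => [[S1 r1]|] //= [->] [<-].
  by exists (sequent_or S' G), r1, (subtest T' [:: i]); rewrite neg_sequent_or.
case: r {epi rT'} => [v k l [ek el _]|k i0 [F [G [ek rF iG _ nx]]]|
                  k [F [ek rF _ nx]]]; rewrite !onth_neg_sequent ek.
(* A valid axiom has no child [c]; what remains is to refute that the axiom condition fails on the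
   negated components. *)
- case: asboolP => // -[]; split; first by rewrite /= neg_pos_var.
  by rewrite el /= neg_neg_var.
- rewrite /= root_neg rF immediate_neg iG /=.
  by case: eqP => // ei; subst i0; apply: step.
rewrite /= root_neg rF /= immediate_neg.
by case iG: (immediate F i) => [G|] //=; apply: step; apply: nx.
Qed.

(** Errors get no label, so that the relabeling makes sense for every test and environment. *)
Definition conf_label (c : configuration) : option (sequent * rule) :=
  if c is Conf T E then Some (neg_environment E, root T) else None.

Definition derivation_fun (c : configuration) (p : position) :=
  obind conf_label (interaction_tree c p).

(** [Error] has no children, so deleting the errors keeps the domain closed under prefixes. *)
Lemma derivation_prefix T E p q :
  isSome (derivation_fun (Conf T E) (p ++ q)) ->
  isSome (derivation_fun (Conf T E) p).
Proof.
rewrite /derivation_fun; elim: p T E => // i p IH T E.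
rewrite cat_cons !interaction_tree_cons.
case: (child _ i) => [[T' E'|]|] //; first exact: IH.
by case: p {IH} => //; case: q.
Qed.

Definition derivation_tree (T : test) (E : environment) :=
  @Tree _ (derivation_fun (Conf T E)) isT (@derivation_prefix T E).

Lemma derivation_treeP T E p S r :
  derivation_tree T E p = Some (S, r) ->
  exists2 T', interaction_tree (Conf T E) p = Some (Conf T' (neg_sequent S))
            & root T' = r.
Proof.
rewrite [derivation_tree _ _ _]/= /derivation_fun.
case: (interaction_tree _ p) => [[T' E'|]|] //=.
by case=> <- <-; exists T'; rewrite ?neg_environmentK.
Qed.

Lemma comes_from_derivation_tree T E : comes_from T (derivation_tree T E).
Proof.
move=> p; rewrite /dom; case e: (derivation_tree T E p) => [[S r]|//] _.
by have [T' /interaction_rule -> ->] := derivation_treeP e.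
Qed.

Lemma no_error_is_derivation T E :
  no_error T E -> is_derivation (derivation_tree T E).
Proof.
move=> noerr p S r e; have [T' eI rT'] := derivation_treeP e.
have nx i : derivation_tree T E (p ++ [:: i]) =
    obind conf_label (child (Conf T' (neg_sequent S)) i).
  by rewrite [LHS]/= /derivation_fun interaction_tree_child eI.
(* [error_child] puts [Error] at index 0, so this one inequality excludes every failing branch of
   [child]. *)
have ok : child (Conf T' (neg_sequent S)) 0 <> Some Error.
  by have := noerr (p ++ [:: 0]); rewrite interaction_tree_child eI.
have dp : dom (derivation_tree T E) p by rewrite /dom e.
move: nx ok; rewrite /= rT'; case: r {e rT'} => [v k l|k i0|k] nx;
  rewrite !onth_neg_sequent in nx *.
- case: asboolP nx => // -[ek el] nx _; split.
  + by apply: omap_neg_eq; rewrite neg_pos_var.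
  + by apply: omap_neg_eq; rewrite neg_neg_var.
  + by apply: leaf_no_child => // i; rewrite /dom /= nx.
- case: (onth _ k) nx => [F|] //=; rewrite root_neg immediate_neg.
  case rF: (root F) => [[]||] //=; case iG: (immediate F i0) => [G|] //= nx _.
  exists F, G; split=> // [i|].
    by rewrite /dom /= nx; case: eqP.
  by rewrite nx eqxx /= -neg_sequent_or neg_sequentK.
case: (onth _ k) nx => [F|] //=; rewrite root_neg.
case rF: (root F) => [[]||] //= nx _; exists F; split=> // [i|i G iG].
  (* Negation preserves arity, so the children are indexed by the immediate subformulas of [F]. *)
  rewrite /dom /= nx immediate_neg -/(dom F [:: i]) -isSome_immediate.
  by case: (immediate F i).
by rewrite nx immediate_neg iG /= -neg_sequent_or neg_sequentK.
Qed.

Theorem mainTheorem2 (S : sequent) (T : test) :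
  (exists pi, derivation_of pi S /\ comes_from T pi)
  <-> no_error T (neg_sequent S).
Proof.
split=> [[pi [der from]]|noerr]; first exact: derivation_no_error der from.
exists (derivation_tree T (neg_sequent S)).
split; last exact: comes_from_derivation_tree.
split; first exact: no_error_is_derivation.
by rewrite (@root_eq _ _ (S, root T)) //= /derivation_fun /= neg_sequentK.
Qed.
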